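(* Let $H=(V,E,w)$ be a hypergraph as in the context. Then its hop-diameter satisfies $\mathrm{diam}(H)=O\!\left(\frac{\log N_w}{\gamma_2}\right)$, i.e. there is an absolute constant $C$ with $\mathrm{diam}(H)\le C\frac{\log N_w}{\gamma_2}$, where $N_w:=\max_{u\in V}\frac{w(V)}{w_u}$.
   Context: $H=(V,E,w)$: $V$ finite, $n=|V|\ge2$, each hyperedge a nonempty subset of $V$, $w_e\ge0$, vertex weights $w_v=\sum_{e\ni v}w_e>0$, $w(V)=\sum_v w_v$, $W=\mathrm{diag}(w_v)$, $\mathbf{1}$ all-ones. Normalized discrepancy ratio $\mathcal{D}(x)=\frac{\sum_{e}w_e\max_{u,v\in e}(x_u/\sqrt{w_u}-x_v/\sqrt{w_v})^2}{\sum_u x_u^2}$ for $x\ne0$, and $\gamma_2=\min\{\mathcal{D}(x):0\ne x\perp W^{1/2}\mathbf{1}\}$. A path is a list of hyperedges $e_1,\dots,e_l$ with $e_i\cap e_{i+1}\ne\emptyset$ for $i\in[l-1]$; its length is $l$; it connects $u,v$ if $u\in e_1$ and $v\in e_l$. The hop-diameter $\mathrm{diam}(H)$ is the smallest $l\in\mathbb{N}$ such that every pair $u,v\in V$ is connected by a path of length at most $l$. *)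

(* Defs.v *)
From HB Require Import structures.
From mathcomp Require Import all_boot all_order all_algebra.
From mathcomp Require Import all_classical all_reals all_analysis.
Set Implicit Arguments.
Unset Strict Implicit.
Unset Printing Implicit Defensive.
Import Order.TTheory GRing.Theory Num.Theory.
Import numFieldNormedType.Exports.
Local Open Scope classical_set_scope.
Local Open Scope ring_scope.

(* [hweight] is only meaningful on [hedges]: no condition is imposed on, and
   no use is made of, its values elsewhere. *)
Record hypergraph (R : realType) (V : finType) := Hypergraph {
  hedges : {set {set V}};
  hweight : {set V} -> R;
  hedges_neq0 : finset.set0 \notin hedges;
  hweight_ge0 : forall e, e \in hedges -> 0 <= hweight e;
  hvweight_gt0 : forall v : V, 0 < \sum_(e in hedges | v \in e) hweight e
}.

Section Hypergraph.
Context {R : realType} {V : finType}.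
Implicit Types (H : hypergraph R V) (x : {ffun V -> R}) (p : seq {set V}).

Definition vweight H (v : V) : R := \sum_(e in hedges H | v \in e) hweight H e.

Definition total_weight H : R := \sum_(v : V) vweight H v.

(* The maxima below range over nonempty families of nonnegative numbers, so
   that the default value 0 is harmless. *)
Definition discrepancy_sum H x : R :=
  \sum_(e in hedges H) hweight H e *
    \big[Num.max/0]_(u in e) \big[Num.max/0]_(v in e)
      (x u / Num.sqrt (vweight H u) - x v / Num.sqrt (vweight H v)) ^+ 2.

Definition discrepancy_ratio H x : R :=
  discrepancy_sum H x / \sum_(u : V) x u ^+ 2.

Definition sqrt_weights H : {ffun V -> R} :=
  [ffun u => Num.sqrt (vweight H u)].

Definition orthogonal_vec x (y : {ffun V -> R}) : Prop :=
  \sum_(u : V) x u * y u = 0.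

Definition gamma2_values H : set R :=
  [set discrepancy_ratio H x | x in
    [set x | x != 0 /\ orthogonal_vec x (sqrt_weights H)]].

(* The infimum is a minimum when [#|V| >= 2]: see [gamma2_min] below. *)
Definition gamma2 H : R := inf (gamma2_values H).

Definition max_weight_ratio H : R :=
  \big[Num.max/0]_(u : V) (total_weight H / vweight H u).

Definition hpath H p : bool :=
  all (fun e => e \in hedges H) p && sorted (fun e f => e :&: f != finset.set0) p.

Definition connects p (u v : V) : bool :=
  if p is e :: p' then (u \in e) && (v \in last e p') else false.

Definition connected_within H (l : nat) : Prop :=
  forall u v : V, exists p, [/\ hpath H p, connects p u v & (size p <= l)%N].

(* The smallest l such that [connected_within H l], or +oo if there is none,
   i.e. if some pair of vertices is not connected by any path. *)
Definition hop_diam H : \bar R :=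
  ereal_inf [set (l%:R : R)%:E | l in [set l : nat | connected_within H l]].

Lemma hop_diam_min H l0 : connected_within H l0 ->
  exists l, [/\ hop_diam H = (l%:R : R)%:E, connected_within H l &
    forall k, connected_within H k -> (l <= k)%N].
Proof.
move=> Hl0; have ex : exists l, `[< connected_within H l >].
  by exists l0; apply/asboolP.
case: (ex_minnP ex) => l /asboolP Hl lmin.
have lm k : connected_within H k -> (l <= k)%N by move=> /asboolP /lmin.
exists l; split => //; apply/eqP; rewrite eq_le; apply/andP; split.
  by apply: ereal_inf_lbound; exists l.
by apply: le_ereal_inf_tmp => _ [k /= Hk <-]; rewrite lee_fin ler_nat lm.
Qed.

Lemma discrepancy_sum_ge0 H x : 0 <= discrepancy_sum H x.
Proof.
apply: sumr_ge0 => e eE; rewrite mulr_ge0 ?hweight_ge0//.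
by elim/big_ind: _ => // [a b a0 b0|i _]; rewrite ?le_max ?a0 //; exact: bigmax_ge_id.
Qed.

Lemma discrepancy_sumZ H (c : R) x :
  discrepancy_sum H [ffun u => c * x u] = c ^+ 2 * discrepancy_sum H x.
Proof.
have maxZ (A : {set V}) (F : V -> R) : c ^+ 2 * \big[Num.max/0]_(u in A) F u =
    \big[Num.max/0]_(u in A) (c ^+ 2 * F u).
  elim/big_rec2: _ => [|u y1 y2 _ <-]; first by rewrite mulr0.
  by rewrite maxr_pMr// sqr_ge0.
rewrite /discrepancy_sum mulr_sumr; apply: eq_bigr => e _.
rewrite mulrCA; congr (_ * _); rewrite maxZ; apply: eq_bigr => u _.
rewrite maxZ; apply: eq_bigr => v _.
by rewrite -exprMn mulrBr !ffunE !mulrA.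
Qed.

Lemma sumsq_gt0 x : x != 0 -> 0 < \sum_(u : V) x u ^+ 2.
Proof.
move=> x0; rewrite lt_neqAle sumr_ge0 ?andbT; last by move=> *; exact: sqr_ge0.
apply: contra x0; rewrite eq_sym psumr_eq0; last by move=> *; exact: sqr_ge0.
move=> /allP h; apply/eqP/ffunP => u; rewrite ffunE; apply/eqP.
by rewrite -sqrf_eq0; have := h u (mem_index_enum u).
Qed.

Lemma gamma2_min H : (2 <= #|V|)%N ->
  gamma2_values H (gamma2 H) /\ lbound (gamma2_values H) (gamma2 H).
Proof.
move=> V2.
pose g (y : 'rV[R]_#|V|) : {ffun V -> R} := [ffun u => y ord0 (enum_rank u)].
have gc u : continuous (fun y => g y u : R).
  rewrite [X in continuous X](_ : _ = fun y : 'rV[R]_#|V| => y ord0 (enum_rank u)).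
    exact: coord_continuous.
  by apply/funext => y; rewrite ffunE.
pose A := [set y | \sum_(u : V) g y u ^+ 2 = 1 /\
  orthogonal_vec (g y) (sqrt_weights H)].
have sumc (F : V -> 'rV[R]_#|V| -> R) : (forall u, continuous (F u)) ->
    continuous (fun y => \sum_(u : V) F u y).
  by move=> Fc; apply: continuous_big => //; exact: add_continuous.
have contX2 (F : 'rV[R]_#|V| -> R) : continuous F ->
    continuous (fun y => F y ^+ 2).
  by move=> Fc y; apply: continuousM; exact: Fc.
have contB (F G : 'rV[R]_#|V| -> R) : continuous F -> continuous G ->
    continuous (fun y => F y - G y).
  by move=> Fc Gc y; exact: (continuousB (Fc y) (Gc y)).
have contM u (c : R) : continuous (fun y => g y u * c).
  by move=> y; apply: continuousM; [exact: gc|exact: cst_continuous].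
have sqc : continuous (fun y => \sum_(u : V) g y u ^+ 2).
  by apply: sumc => u; apply: contX2; exact: gc.
have oc : continuous (fun y => \sum_(u : V) g y u * sqrt_weights H u).
  by apply: sumc => u; exact: contM.
have norml x (c := (Num.sqrt (\sum_(u : V) x u ^+ 2))^-1) : x != 0 ->
    orthogonal_vec x (sqrt_weights H) ->
    exists2 y, A y & g y = [ffun u => c * x u].
  move=> x0 xo; pose y : 'rV[R]_#|V| := \row_i (c * x (enum_val i)).
  have gy : g y = [ffun u => c * x u].
    by apply/ffunP => u; rewrite !ffunE mxE enum_rankK.
  exists y => //; rewrite /A /= gy; split.
    under eq_bigr do rewrite ffunE exprMn.
    rewrite -mulr_sumr exprVn sqr_sqrtr ?mulVf//.
      by rewrite gt_eqF// sumsq_gt0.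
    by rewrite ltW// sumsq_gt0.
  rewrite /orthogonal_vec; under eq_bigr do rewrite ffunE -mulrA.
  by rewrite -mulr_sumr xo mulr0.
have [a [b ab]] : exists a b : V, a != b.
  by case/card_gt1P : V2 => a [b [_ _ ab]]; exists a, b.
have A0 : A !=set0.
  pose s := sqrt_weights H.
  pose x : {ffun V -> R} :=
    [ffun u => if u == a then s b else if u == b then - s a else 0].
  have sgt0 u : 0 < s u by rewrite ffunE sqrtr_gt0 hvweight_gt0.
  have x0 : x != 0.
    apply/eqP => /ffunP /(_ a); rewrite !ffunE eqxx => /eqP.
    by rewrite sqrtr_eq0 leNgt hvweight_gt0.
  have xo : orthogonal_vec x s.
    rewrite /orthogonal_vec (bigD1 a)//= (bigD1 b) 1?eq_sym//= big1.
      rewrite ![x _]ffunE eqxx (eq_sym b) (negbTE ab) eqxx addr0 mulNr.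
      by rewrite mulrC subrr.
    by move=> u /andP[ua ub]; rewrite ffunE (negbTE ua) (negbTE ub) mul0r.
  by have [y Ay _] := norml _ x0 xo; exists y.
have Acl : closed A.
  rewrite (_ : A = (fun y => \sum_(u : V) g y u ^+ 2) @^-1` [set 1] `&`
    (fun y => \sum_(u : V) g y u * sqrt_weights H u) @^-1` [set 0]) //.
  apply: closedI; apply: preimage_closed; try exact: closed_eq.
    by move=> y _; exact: sqc.
  by move=> y _; exact: oc.
have Ab : bounded_set A.
  exists 1; split; first exact: real1.
  move=> M M1 y [y1 _]; apply: (le_trans _ (ltW M1)).
  rewrite /Num.norm /= mx_normrE; apply: bigmax_le => // -[i j] _ /=.
  rewrite -(@expr_le1 _ 2)// real_normK ?num_real// -y1 (ord1 i).
  rewrite -(enum_valK j) (bigD1 (enum_val j))//= ffunE lerDl sumr_ge0//.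
  by move=> *; exact: sqr_ge0.
have Fc : continuous (fun y => discrepancy_sum H (g y)).
  rewrite /discrepancy_sum.
  have maxc (S : {set V}) (F : V -> 'rV[R]_#|V| -> R) :
      (forall u, continuous (F u)) ->
      continuous (fun y => \big[Num.max/0]_(u in S) F u y).
    by move=> Fc; apply: continuous_big => //; exact: max_continuous.
  apply: continuous_big => //; first exact: add_continuous.
  move=> e _ y; apply: continuousM; first exact: cst_continuous.
  apply: (maxc e _ _ y) => u; apply: (maxc) => v.
  by apply: contX2; apply: contB; exact: contM.
have [y0 Ay0 y0min] := compact_EVT_min A0 (bounded_closed_compact Ab Acl)
  (continuous_subspaceT Fc).
have m : gamma2_values H (discrepancy_sum H (g y0)).
  move: Ay0; rewrite inE => -[y1 yo]; exists (g y0) => /=; last first.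
    by rewrite /discrepancy_ratio y1 divr1.
  split => //; apply: contra_eq_neq y1 => ->.
  by rewrite big1 1?eq_sym ?oner_eq0// => u _; rewrite ffunE expr0n.
have lb : lbound (gamma2_values H) (discrepancy_sum H (g y0)).
  move=> _ [x /= [x0 xo] <-]; have [y Ay gy] := norml _ x0 xo.
  have := y0min y; rewrite inE => /(_ Ay); rewrite gy discrepancy_sumZ.
  rewrite exprVn sqr_sqrtr; first by rewrite /discrepancy_ratio mulrC.
  by rewrite ltW// sumsq_gt0.
suff -> : gamma2 H = discrepancy_sum H (g y0) by [].
apply/eqP; rewrite eq_le; apply/andP; split.
  by apply: ge_inf => //; exists (discrepancy_sum H (g y0)).
by apply: lb_le_inf => //; exists (discrepancy_sum H (g y0)).
Qed.

End Hypergraph.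

(* Main.v *)
Require Import Defs.
From mathcomp Require Import all_boot all_order all_algebra.
From mathcomp Require Import all_classical all_reals all_analysis.
From mathcomp Require Import ring lra.
Set Implicit Arguments.
Unset Strict Implicit.
Unset Printing Implicit Defensive.
Import Order.TTheory GRing.Theory Num.Theory.
Local Open Scope ring_scope.

(** Testing [gamma2] on the centred indicator function of a set [S] with
    w(S) <= w(V)/2 shows that the hyperedges crossing [S] have total weight at
    least (gamma2 / 2) w(S). A hyperedge crossing a ball of radius l around u
    contributes its weight to a vertex of the next ball, so the weights of the
    balls grow by a factor 1 + gamma2 / 2 until they exceed w(V)/2, which takes
    O(log N_w / gamma2) steps. Two balls of weight more than w(V)/2 intersect. *)

Section Expansion.
Context {R : realType} {V : finType} (H : hypergraph R V).
Implicit Types (A B S e : {set V}) (u v : V) (p q : seq {set V}) (l : nat).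

Local Notation w := (vweight H).
Local Notation W := (total_weight H).

(** * Weights of vertex sets and of cuts *)

Definition set_weight A : R := \sum_(v in A) w v.

Definition crosses S e : bool := (e :&: S != finset.set0) && ~~ (e \subset S).

Definition cut_weight S : R :=
  \sum_(e in hedges H | crosses S e) hweight H e.

(** Exchanging the sums in [set_weight A] counts each hyperedge once per vertex it has in A, hence
    at least once when it satisfies P. *)
Lemma set_weight_cover A (P : pred {set V}) :
  (forall e, e \in hedges H -> P e -> e :&: A != finset.set0) ->
  \sum_(e in hedges H | P e) hweight H e <= set_weight A.
Proof.
move=> PA; rewrite /set_weight /vweight (exchange_big_dep (mem (hedges H))) /=.
  rewrite big_mkcondr /=; apply: ler_sum => e eH.
  have [/(PA _ eH)/finset.set0Pn[v]|_] := ifP; last first.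
    by rewrite sumr_ge0// => v _; exact: hweight_ge0.
  rewrite inE => /andP[ve vA]; rewrite (bigD1 v) ?vA ?eH ?ve//= lerDl.
  by rewrite sumr_ge0// => *; exact: hweight_ge0.
by move=> v e _ /andP[].
Qed.

Lemma total_weightE S : W = set_weight S + set_weight (~: S).
Proof.
rewrite /total_weight (bigID (mem S)) /=; congr (_ + _).
by apply: eq_bigl => v; rewrite inE.
Qed.

Lemma set_weight_gt0 S u : u \in S -> 0 < set_weight S.
Proof.
move=> uS; rewrite /set_weight (bigD1 u)//= ltr_pwDl ?hvweight_gt0//.
by rewrite sumr_ge0// => v _; rewrite ltW ?hvweight_gt0.
Qed.

Lemma set_weight_mono A B : A \subset B -> set_weight A <= set_weight B.
Proof.
move=> /fintype.subsetP AB; rewrite /set_weight [leRHS](finset.big_setID A) /=.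
have -> : B :&: A = A by apply/finset.setIidPr/fintype.subsetP.
by rewrite lerDl sumr_ge0// => v _; rewrite ltW ?hvweight_gt0.
Qed.

(** * Consequences of the variational definition of [gamma2] *)

Lemma discrepancy_sum_indicator S (c : R) :
  discrepancy_sum H [ffun u => Num.sqrt (w u) * ((u \in S)%:R - c)]
  <= cut_weight S.
Proof.
rewrite /discrepancy_sum /cut_weight [leRHS]big_mkcondr /=.
apply: ler_sum => e eH.
(* Dividing by the square roots of the weights leaves the shifted indicator. The shift c cancels in
   differences, so a hyperedge contributes nothing unless it crosses S, and at most its weight if it
   does. *)
have sq u v : ([ffun u => Num.sqrt (w u) * ((u \in S)%:R - c)] u / Num.sqrt (w u)
    - [ffun u => Num.sqrt (w u) * ((u \in S)%:R - c)] v / Num.sqrt (w v)) ^+ 2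
    = ((u \in S) != (v \in S))%:R.
  rewrite !ffunE; have s0 t : Num.sqrt (w t) != 0.
    by rewrite gt_eqF// sqrtr_gt0 hvweight_gt0.
  rewrite ![Num.sqrt _ * _]mulrC !mulfK//.
  by case: (u \in S); case: (v \in S) => /=; ring.
under eq_bigr => u _ do under eq_bigr => v _ do rewrite sq.
have [cr|ncr] := ifPn; last first.
  rewrite big1_idem ?mulr0//; try exact: maxxx.
  move=> u ue; rewrite big1_idem//; try exact: maxxx.
  move=> v ve.
  suff -> : (u \in S) = (v \in S) by rewrite eqxx.
  move: ncr; rewrite negb_and negbK => /orP[/eqP eS|/negPn/fintype.subsetP eS].
    have nS t : t \in e -> t \in S = false.
      by move=> te; move/setP: eS => /(_ t); rewrite !inE te.
    by rewrite !nS.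
  by rewrite !eS.
rewrite ler_piMr ?hweight_ge0//.
by do 2!(apply: bigmax_le => // ? _); rewrite lern1 leq_b1.
Qed.

Lemma gamma2_ge0 : (2 <= #|V|)%N -> 0 <= gamma2 H.
Proof.
move=> V2; have [[y _ <-] _] := gamma2_min H V2.
by rewrite divr_ge0 ?discrepancy_sum_ge0// sumr_ge0// => v _; exact: sqr_ge0.
Qed.

Lemma cut_weight_ge S u : (2 <= #|V|)%N -> u \in S ->
  set_weight S <= W / 2 -> gamma2 H / 2 * set_weight S <= cut_weight S.
Proof.
move=> V2 uS half; have S0 := set_weight_gt0 uS.
have W0 : 0 < W by lra.
(* The weighted mean of the indicator of S: subtracting it makes x orthogonal to [sqrt_weights H].
   The squared norm of x is then w(S)(1 - c), at least w(S)/2 because c <= 1/2; this is the source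
   of the factor 1/2. *)
pose c := set_weight S / W.
have cW : c * W = set_weight S by rewrite divfK// gt_eqF.
have c2 : c <= 1 / 2 by rewrite ler_pdivrMr//; lra.
pose x := [ffun u => Num.sqrt (w u) * ((u \in S)%:R - c)].
have sumS (F : V -> R) : \sum_u F u * (u \in S)%:R = \sum_(u in S) F u.
  by rewrite [RHS]big_mkcond; apply: eq_bigr => v _; case: ifP; rewrite ?mulr1 ?mulr0.
have sqw v : Num.sqrt (w v) ^+ 2 = w v by rewrite sqr_sqrtr// ltW ?hvweight_gt0.
have xx : \sum_u x u ^+ 2 = set_weight S * (1 - c).
  transitivity (\sum_u ((1 - 2 * c) * (w u * (u \in S)%:R) + c ^+ 2 * w u)).
    apply: eq_bigr => v _; rewrite ffunE exprMn sqw.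
    by case: (v \in S) => /=; ring.
  by rewrite big_split /= -!mulr_sumr sumS -/(set_weight S) -/W -cW; ring.
have xo : orthogonal_vec x (sqrt_weights H).
  rewrite /orthogonal_vec.
  transitivity (\sum_u (w u * (u \in S)%:R - c * w u)).
    by apply: eq_bigr => v _; rewrite !ffunE -[in RHS]sqw; ring.
  by rewrite big_split /= sumrN -mulr_sumr sumS -/(set_weight S) -/W cW subrr.
have xx0 : 0 < \sum_u x u ^+ 2 by rewrite xx mulr_gt0//; lra.
have x0 : x != 0.
  apply: contraTneq xx0 => ->; rewrite big1 ?ltxx// => v _.
  by rewrite ffunE expr0n.
have [_ lb] := gamma2_min H V2.
have := lb (discrepancy_ratio H x) (ex_intro2 _ _ x (conj x0 xo) erefl).
rewrite /discrepancy_ratio ler_pdivlMr// => gx.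
have g0 := gamma2_ge0 V2.
apply: le_trans (discrepancy_sum_indicator S c); apply: le_trans gx.
rewrite xx -mulrA ler_wpM2l// mulrC ler_wpM2l ?(ltW S0)//; lra.
Qed.

Lemma half_vweight : (2 <= #|V|)%N -> exists u, w u <= W / 2.
Proof.
move=> /card_gt1P[a [b [_ _ ab]]].
have ge : w a + w b <= W.
  rewrite /total_weight (bigD1 a)//= (bigD1 b) 1?eq_sym//= addrA lerDl.
  by rewrite sumr_ge0// => v _; rewrite ltW ?hvweight_gt0.
by have [?|?] := leP (w a) (w b); [exists a|exists b]; lra.
Qed.

(** The cut around a single light vertex weighs no more than the vertex itself. This keeps the
    growth rate [gamma2 H / 2] in [0, 1], as [expR_le_pow] requires. *)
Lemma gamma2_le2 : (2 <= #|V|)%N -> gamma2 H <= 2.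
Proof.
move=> V2; have [u uW] := half_vweight V2.
have su : set_weight [set u]%SET = w u by rewrite /set_weight big_set1.
have wu : 0 < w u by exact: hvweight_gt0.
have := cut_weight_ge V2 (set11 u); rewrite su => /(_ uW) le1.
have : cut_weight [set u]%SET <= w u.
  by rewrite -su; apply: set_weight_cover => e _ /andP[].
move=> /(le_trans le1); rewrite ger_pMl//; lra.
Qed.

(** * Balls: their growth and the paths inside them *)

Definition expand S : {set V} :=
  finset (fun v => (v \in S) ||
    [exists e, [&& e \in hedges H, v \in e & e :&: S != finset.set0]]).

Definition ball l u : {set V} := iter l expand [set u]%SET.

Lemma sub_expand S : S \subset expand S.
Proof. by apply/fintype.subsetP => v vS; rewrite inE vS. Qed.

Lemma mem_ball l u : u \in ball l u.
Proof.
elim: l => [|l IH]; first exact: set11.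
by rewrite /ball iterS; exact: (fintype.subsetP (sub_expand _)).
Qed.

Lemma set_weight_expand S : set_weight S + cut_weight S <= set_weight (expand S).
Proof.
rewrite [leRHS]/set_weight (finset.big_setID S) /=.
have -> : expand S :&: S = S by apply/finset.setIidPr; exact: sub_expand.
(* A crossing hyperedge meets S, so all its vertices lie in [expand S]; one of them is outside S and
   pays for it. *)
rewrite lerD2l; apply: set_weight_cover => e eH /andP[eS /fintype.subsetPn[v ve vS]].
apply/finset.set0Pn; exists v; rewrite !inE ve vS (negbTE vS) /=.
by apply/existsP; exists e; rewrite eH ve.
Qed.

(** The cut bound is only available up to weight W/2; past that threshold, monotonicity preserves
    the first alternative. *)
Lemma ball_growth l u : (2 <= #|V|)%N ->
  W / 2 < set_weight (ball l u) \/
  (1 + gamma2 H / 2) ^+ l * w u <= set_weight (ball l u).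
Proof.
move=> V2; elim: l => [|l IH].
  by right; rewrite expr0 mul1r /ball /= /set_weight big_set1.
have mono : set_weight (ball l u) <= set_weight (ball l.+1 u).
  exact/set_weight_mono/sub_expand.
have [big|small] := ltP (W / 2) (set_weight (ball l u)).
  by left; exact: lt_le_trans mono.
case: IH => [|IH]; first by rewrite ltNge small.
right; apply: le_trans (set_weight_expand _).
have := cut_weight_ge V2 (mem_ball l u) small.
have t0 : 0 <= 1 + gamma2 H / 2 by have := gamma2_ge0 V2; lra.
rewrite exprS -mulrA; have := ler_wpM2l t0 IH; lra.
Qed.

(** For l = 1: exp(t/2) <= 1/(1 - t/2) <= 1 + t, the last step because (1 + t)(1 - t/2) = 1 + t(1 -
    t)/2 >= 1. *)
Lemma expR_le_pow (t : R) l : 0 <= t <= 1 -> expR (l%:R * (t / 2)) <= (1 + t) ^+ l.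
Proof.
move=> /andP[t0 t1]; rewrite expRM_natl.
apply: lerXn2r; rewrite ?nnegrE ?expR_ge0//; first lra.
have := expR_ge1Dx (- (t / 2)); have := expR_gt0 (t / 2).
rewrite expRN => e0 le1; have : expR (t / 2) * (1 - t / 2) <= 1.
  by rewrite mulrC -ler_pdivlMr// div1r.
nra.
Qed.

(* The bound is [l.+1] because [ball 0 u] is [u] itself, while [connects] is
   false on the empty path. *)
Lemma ball_path l u v : v \in ball l u ->
  exists p, [/\ hpath H p, connects p u v & (size p <= l.+1)%N].
Proof.
elim: l v => [|l IH] v.
  rewrite inE => /eqP ->.
  have [e /andP[eH ue]] : exists e, (e \in hedges H) && (u \in e).
    apply/existsP; apply: contraT => /existsPn nex.
    have := hvweight_gt0 H u; rewrite big_pred0 ?ltxx// => e.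
    exact/negbTE/nex.
  by exists [:: e]; rewrite /hpath /= eH ue.
rewrite /ball iterS inE => /orP[/IH[p [? ? s]]|]; first by exists p; rewrite leqW.
move=> /existsP[e /and3P[eH ve /finset.set0Pn[z]]].
rewrite inE => /andP[ze /IH[[|f p] [//]]].
move=> /andP[pH ps] /andP[uf zl] sp.
exists (rcons (f :: p) e); split.
- rewrite /hpath all_rcons eH pH /= rcons_path (ps : path _ f p) /=.
  by apply/finset.set0Pn; exists z; rewrite inE zl.
- by rewrite /= uf last_rcons.
- by rewrite size_rcons.
Qed.

(** * Joining paths and bounding the diameter *)

Lemma connects_rev p u v : hpath H p -> connects p u v ->
  hpath H (rev p) /\ connects (rev p) v u.
Proof.
move=> /andP[pH ps] pc; split.
  rewrite /hpath all_rev pH rev_sorted; apply: sub_sorted ps => e f.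
  by rewrite finset.setIC.
case: p pc {pH ps} => [//|e p]; case/lastP: p => [|p f] /= /andP[ue].
  by rewrite ue => ->.
by rewrite last_rcons rev_cons rev_rcons /= last_rcons => -> .
Qed.

Lemma connects_cat p q u v z : hpath H p -> hpath H q ->
  connects p u z -> connects q z v -> hpath H (p ++ q) /\ connects (p ++ q) u v.
Proof.
case: p q => [|e p] [|f q] // /andP[pH ps] /andP[qH qs] /andP[ue zp] /andP[zf vq].
split; last by rewrite /= ue last_cat.
rewrite /hpath all_cat pH qH /= cat_path (ps : path _ e p) /= (qs : path _ f q) andbT.
by apply/finset.set0Pn; exists z; rewrite inE zp.
Qed.

Lemma connected_within_ball l : (forall u, W / 2 < set_weight (ball l u)) ->
  connected_within H (l.+1 + l.+1).
Proof.
move=> big u v.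
have [z] : exists z, z \in ball l u :&: ball l v.
  apply/finset.set0Pn/negP.
  rewrite finset.setI_eq0 disjoint_sym finset.disjoints_subset.
  move=> /set_weight_mono; have := big u; have := big v.
  have := total_weightE (ball l u); lra.
rewrite inE => /andP[/ball_path[p [pH pc sp]] /ball_path[q [qH qc sq]]].
have [qH' qc'] := connects_rev qH qc.
(* The path from u to the common vertex z is followed by the reversed path from v to z. *)
have [h c] := connects_cat pH qH' pc qc'.
by exists (p ++ rev q); rewrite size_cat size_rev leq_add.
Qed.

Lemma le_max_weight_ratio u : W / w u <= max_weight_ratio H.
Proof. by rewrite /max_weight_ratio (bigD1 u)//= le_max lexx. Qed.

Lemma max_weight_ratio_ge2 : (2 <= #|V|)%N -> 2 <= max_weight_ratio H.
Proof.
move=> V2; have [u uW] := half_vweight V2; apply: le_trans (le_max_weight_ratio u).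
by rewrite ler_pdivlMr ?hvweight_gt0//; lra.
Qed.

Lemma hop_diam_le l : (2 <= #|V|)%N ->
  ln (max_weight_ratio H) <= l%:R * (gamma2 H / 4) ->
  (hop_diam H <= ((l.+1 + l.+1)%:R : R)%:E)%E.
Proof.
move=> V2 lnN; apply: ereal_inf_lbound; exists (l.+1 + l.+1)%N => //=.
apply: connected_within_ball => u.
have [//|] := ball_growth l u V2; apply: lt_le_trans.
have N2 := max_weight_ratio_ge2 V2.
have wu : 0 < w u by exact: hvweight_gt0.
have W0 : 0 < W.
  apply: lt_le_trans wu _; rewrite /total_weight (bigD1 u)//= lerDl sumr_ge0// => v _.
  by rewrite ltW ?hvweight_gt0.
(* The growth factor (1 + gamma2/2)^l is at least exp(l gamma2/4) >= N_w >= W / w u, so the second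
   alternative would already give the ball weight W. *)
apply: (@lt_le_trans _ _ W); first lra.
rewrite -ler_pdivrMr//; apply: le_trans (le_max_weight_ratio u) _.
rewrite -[leLHS]lnK ?posrE; last lra.
apply: le_trans (expR_le_pow l _); first by rewrite ler_expR; lra.
have := gamma2_ge0 V2; have := gamma2_le2 V2; lra.
Qed.

End Expansion.

(* When gamma2 H = 0 the right-hand side is +oo: 0^-1 = +oo in \bar R, and
   max_weight_ratio H > 1 since there are at least two vertices. *)
Theorem mainTheorem5 (R : realType) :
  exists C : R, 0 < C /\
    forall (V : finType) (H : hypergraph R V), (2 <= #|V|)%N ->
      (hop_diam H <= (C * ln (max_weight_ratio H))%:E / (gamma2 H)%:E)%E.
Proof.
have l2 : 0 < ln (2 : R) by rewrite ln_gt0// ltr1n.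
have l2V : 0 < (ln (2 : R))^-1 by rewrite invr_gt0.
(* With x = 4 ln N / g and radius [(Num.truncn x).+1], the diameter is at most 2x + 4. The term 2x
   gives the 8; the additive 4 is absorbed using 2/g >= 1 and ln N / ln 2 >= 1, which gives the 8 /
   ln 2. *)
exists (8 + 8 * (ln 2)^-1); split; first lra.
move=> V H V2; set N := max_weight_ratio H; set g := gamma2 H.
have N2 : 2 <= N by exact: max_weight_ratio_ge2.
have lnN : ln 2 <= ln N by rewrite ler_ln ?posrE//; lra.
have C0 : 0 < (8 + 8 * (ln 2)^-1) * ln N by rewrite mulr_gt0//; lra.
rewrite inver; have [_|g0] := eqVneq g 0.
  by rewrite gt0_muley ?lte_fin// leey.
have gp : 0 < g by rewrite lt_neqAle eq_sym g0 gamma2_ge0.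
have g2 : g <= 2 by exact: gamma2_le2.
pose x := 4 * ln N / g.
have x0 : 0 <= x by rewrite divr_ge0//; lra.
have /andP[lex ltx] := truncn_itv x0.
apply: le_trans (@hop_diam_le _ _ H (Num.truncn x).+1 V2 _) _.
  apply: le_trans (ler_wpM2r _ (ltW ltx)); last lra.
  by rewrite /x le_eqVlt; apply/orP; left; apply/eqP; field.
rewrite lee_fin natrD -[_.+2]addn2 natrD.
have ig : 1 <= 2 / g by rewrite ler_pdivlMr// mul1r.
have il : 1 <= ln N / ln 2 by rewrite ler_pdivlMr// mul1r.
have := ler_pM _ _ ig il; rewrite mulr1 => /(_ ler01 ler01).
have -> : (8 + 8 * (ln 2)^-1) * ln N / g = 2 * x + 4 * (2 / g * (ln N / ln 2)).
  by rewrite /x; field; rewrite g0 gt_eqF.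
move: lex; move: (Num.truncn x)%:R => k; lra.
Qed.
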